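(* Let $(M,g)$ be a space-time with Ricci tensor $Ric$ and scalar curvature $s$, and let $T=Ric-\tfrac12 s\,g$ be the energy-momentum tensor given by the Einstein equations. Then the Einstein equations belong to the class $\Omega_3$, i.e. $\nabla T$ is a section of the subbundle $\Omega_3(M)$, if and only if $(M,g)$ is a Sinyukov space $L_4$.
   Context: A space-time $(M,g)$ is a smooth four-dimensional manifold $M$ with a metric $g$ of Lorentz signature $(-+++)$; $\nabla$ is its Levi-Civita connection. The curvature tensor is given by $R^k_{lij}X^l=\nabla_i\nabla_jX^k-\nabla_j\nabla_iX^k$, the Ricci tensor by $R_{ij}=R^k_{ikj}$, and the scalar curvature by $s=g^{ij}R_{ij}$. The Einstein equations are $R_{ij}-\tfrac12 s\,g_{ij}=T_{ij}$; in particular $g^{ik}\nabla_iT_{kj}=0$. Let $\Omega(M)\subset T^*M\otimes S^2M$ (with $S^2M$ the bundle of symmetric covariant 2-tensors) be the bundle whose fiber at $x\in M$ consists of the trilinear forms $\Omega$ on $T_xM$ with components satisfying $\Omega_{kij}=\Omega_{kji}$ and $g^{ki}\Omega_{kij}=0$. Then $\nabla T$, with components $\nabla_kT_{ij}$, is a section of $\Omega(M)$. The bundle $\Omega(M)$ has a pointwise decomposition, irreducible under the pseudo-orthogonal group, $\Omega(M)=\Omega_1(M)\oplus\Omega_2(M)\oplus\Omega_3(M)$, where $\Omega_1(M)$ consists of the elements with $\Omega_{kij}+\Omega_{ijk}+\Omega_{jki}=0$, $\Omega_2(M)$ consists of the elements with $\Omega_{kij}=\Omega_{ikj}$, and $\Omega_3(M)$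 is the orthogonal complement of $\Omega_1(M)\oplus\Omega_2(M)$ in $\Omega(M)$ with respect to the inner product induced by $g$. The Einstein equations belong to the class $\Omega_3$ if $\nabla T$ is a section of $\Omega_3(M)$; this class is selected by the condition $$\nabla_kR_{ij}=\frac{1}{18}\left(4(\partial_ks)g_{ij}+(\partial_is)g_{kj}+(\partial_js)g_{ik}\right).$$ A Sinyukov space $L_4$ is a four-dimensional pseudo-Riemannian manifold whose scalar curvature $s$ is non-constant and whose Ricci tensor satisfies this same displayed equation.
   Formalization: The implication from class Ω₃ to Sinyukov space additionally assumes that ∇T is not identically zero, since for example Minkowski space has ∇T = 0 in Ω₃ but constant scalar curvature; the converse is as stated. *)

(* Defs.v *)
From mathcomp Require Import all_boot all_order all_algebra.
From mathcomp Require Import all_classical all_reals all_analysis.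

Set Implicit Arguments.
Unset Strict Implicit.
Unset Printing Implicit Defensive.

Import Order.TTheory GRing.Theory Num.Theory.
Import numFieldNormedType.Exports.

Local Open Scope classical_set_scope.
Local Open Scope ring_scope.

Section Smoothness.
Variable R : realType.

Definition partial (i : 'I_4) (f : 'rV[R]_4 -> R) (p : 'rV[R]_4) : R :=
  'D_(delta_mx 0 i) f p.

Fixpoint Ck_on (k : nat) (U : set 'rV[R]_4) (f : 'rV[R]_4 -> R) : Prop :=
  (forall p, U p -> {for p, continuous f}) /\
  match k with
  | 0%N => True
  | k'.+1 => forall i : 'I_4,
      (forall p, U p -> derivable f p (delta_mx 0 i)) /\
      Ck_on k' U (partial i f)
  end.

(* Meant for open U: the values of f outside U are then irrelevant. *)
Definition smooth_on (U : set 'rV[R]_4) (f : 'rV[R]_4 -> R) : Prop :=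
  forall k, Ck_on k U f.

End Smoothness.

(* A chart is a homeomorphism from an open set of M onto an open set of R^4.
   Both directions are total functions; chart_map is meaningful on chart_dom
   only, and chart_inv on the image of chart_dom only. *)
Record chart (R : realType) (M : topologicalType) := Chart {
  chart_dom : set M;
  chart_map : M -> 'rV[R]_4;
  chart_inv : 'rV[R]_4 -> M;
  chart_dom_open : open chart_dom;
  chart_img_open : open (chart_map @` chart_dom);
  chart_mapK : forall x, chart_dom x -> chart_inv (chart_map x) = x;
  chart_map_continuous :
    forall x, chart_dom x -> {for x, continuous chart_map};
  chart_inv_continuous :
    forall x, chart_dom x -> {for chart_map x, continuous chart_inv}
}.

Definition chart_img (R : realType) (M : topologicalType) (c : chart R M) :
  set 'rV[R]_4 := chart_map c @` chart_dom c.

Definition transition (R : realType) (M : topologicalType) (c c' : chart R M)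
  (p : 'rV[R]_4) : 'rV[R]_4 := chart_map c' (chart_inv c p).

Definition overlap (R : realType) (M : topologicalType) (c c' : chart R M) :
  set 'rV[R]_4 := chart_map c @` (chart_dom c `&` chart_dom c').

Record manifold4 (R : realType) := Manifold4 {
  mcarrier :> topologicalType;
  mhausdorff : hausdorff_space mcarrier;
  mcountable : @second_countable mcarrier;
  atlas : set (chart R mcarrier);
  atlas_cover : forall x, exists2 c, atlas c & chart_dom c x;
  atlas_smooth : forall c c', atlas c -> atlas c' -> forall a : 'I_4,
    smooth_on (overlap c c') (fun p => transition c c' p 0 a)
}.

(* A pseudo-Riemannian metric, given by its component matrices g_ij in each
   chart; metric_comp c p is meaningful for c in the atlas and p in the image
   of c. The last field is the law g_ij = (d_i y^a) (d_j y^b) g'_ab for the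
   change of coordinates y = transition c c'. *)
Record pseudo_metric (R : realType) (M : manifold4 R) := PseudoMetric {
  metric_comp : chart R M -> 'rV[R]_4 -> 'M[R]_4;
  metric_smooth : forall c, atlas c -> forall i j,
    smooth_on (chart_img c) (fun p => metric_comp c p i j);
  metric_sym : forall c p, atlas c -> chart_img c p ->
    (metric_comp c p)^T = metric_comp c p;
  metric_nondeg : forall c p, atlas c -> chart_img c p ->
    metric_comp c p \in unitmx;
  metric_tensor : forall c c' p, atlas c -> atlas c' -> overlap c c' p ->
    forall i j, metric_comp c p i j =
      \sum_a \sum_b
        partial i (fun q => transition c c' q 0 a) p *
        partial j (fun q => transition c c' q 0 b) p *
        metric_comp c' (transition c c' p) a b
}.

Section LocalTensorCalculus.
Variable R : realType.
Variable g : 'rV[R]_4 -> 'M[R]_4.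
Implicit Types p : 'rV[R]_4.

(* g^{ij} *)
Definition metric_inv p : 'M[R]_4 := invmx (g p).

(* Gamma^k_{ij} *)
Definition christoffel (k i j : 'I_4) p : R :=
  2^-1 * \sum_l metric_inv p k l *
    (partial i (fun q => g q j l) p + partial j (fun q => g q i l) p
     - partial l (fun q => g q i j) p).

(* (nabla X)_j^k = nabla_j X^k *)
Definition nabla_vector (X : 'I_4 -> 'rV[R]_4 -> R) (j k : 'I_4) p : R :=
  partial j (X k) p + \sum_m christoffel k j m p * X m p.

(* nabla_i Y_j^k, for a tensor field Y of type (1,1) *)
Definition nabla_mixed (Y : 'I_4 -> 'I_4 -> 'rV[R]_4 -> R) (i j k : 'I_4) p
    : R :=
  partial i (Y j k) p + \sum_m christoffel k i m p * Y j m p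
  - \sum_m christoffel m i j p * Y m k p.

(* nabla_k T_ij *)
Definition nabla_covariant (T : 'rV[R]_4 -> 'M[R]_4) p (k i j : 'I_4) : R :=
  partial k (fun q => T q i j) p - \sum_m christoffel m k i p * T p m j
  - \sum_m christoffel m k j p * T p i m.

Definition coord_field (l a : 'I_4) p : R := (a == l)%:R.

(* R^k_{lij}: the identity R^k_{lij} X^l = nabla_i nabla_j X^k
   - nabla_j nabla_i X^k for X the l-th coordinate vector field. *)
Definition riemann (k l i j : 'I_4) p : R :=
  nabla_mixed (nabla_vector (coord_field l)) i j k p
  - nabla_mixed (nabla_vector (coord_field l)) j i k p.

(* R_ij = R^k_{ikj} *)
Definition ricci p : 'M[R]_4 := \matrix_(i, j) \sum_k riemann k i k j p.

Definition scal p : R := \sum_i \sum_j metric_inv p i j * ricci p i j.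

Definition energy_momentum p : 'M[R]_4 := ricci p - (2^-1 * scal p) *: g p.

End LocalTensorCalculus.

Section TrilinearForms.
Variable R : realType.

Definition trilinear := 'I_4 -> 'I_4 -> 'I_4 -> R.

(* G is the matrix g_ij of the metric at a point. *)
Variable G : 'M[R]_4.
Implicit Types w u v : trilinear.

Definition inner w u : R :=
  \sum_k \sum_i \sum_j \sum_k' \sum_i' \sum_j'
    invmx G k k' * invmx G i i' * invmx G j j' * w k i j * u k' i' j'.

Definition in_Omega w : Prop :=
  (forall k i j, w k i j = w k j i) /\
  (forall j, \sum_k \sum_i invmx G k i * w k i j = 0).

Definition in_Omega1 w : Prop :=
  in_Omega w /\ (forall k i j, w k i j + w i j k + w j k i = 0).

Definition in_Omega2 w : Prop :=
  in_Omega w /\ (forall k i j, w k i j = w i k j).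

Definition in_Omega3 w : Prop :=
  in_Omega w /\
  (forall u v, in_Omega1 u -> in_Omega2 v ->
     inner w (fun k i j => u k i j + v k i j) = 0).

End TrilinearForms.

Section Classes.
Variables (R : realType) (M : manifold4 R) (g : pseudo_metric M).

Definition minkowski : 'M[R]_4 :=
  diag_mx (\row_(i < 4) (if i == 0 then -1 else 1)).

(* Signature (-+++), witnessed at each point by a pseudo-orthonormal frame. *)
Definition lorentzian : Prop :=
  forall c p, atlas c -> chart_img c p ->
    exists2 P : 'M[R]_4, P \in unitmx &
      metric_comp g c p = P^T *m minkowski *m P.

Definition nabla_energy_momentum (c : chart R M) : 'rV[R]_4 -> trilinear R :=
  nabla_covariant (metric_comp g c) (energy_momentum (metric_comp g c)).

Definition parallel_energy_momentum : Prop :=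
  forall c p, atlas c -> chart_img c p ->
    forall k i j, nabla_energy_momentum c p k i j = 0.

Definition einstein_class_Omega3 : Prop :=
  forall c p, atlas c -> chart_img c p ->
    in_Omega3 (metric_comp g c p) (nabla_energy_momentum c p).

(* The scalar curvature is a function on M, of which scal (metric_comp g c) is
   the expression in the chart c; it is constant iff all these expressions
   take one and the same value. *)
Definition constant_scal : Prop :=
  exists a : R, forall c p, atlas c -> chart_img c p ->
    scal (metric_comp g c) p = a.

Definition sinyukov_equation : Prop :=
  forall c p, atlas c -> chart_img c p -> forall k i j : 'I_4,
    let gc := metric_comp g c in
    nabla_covariant gc (ricci gc) p k i j =
      18%:R^-1 * (4%:R * partial k (scal gc) p * gc p i j
                  + partial i (scal gc) p * gc p k j
                  + partial j (scal gc) p * gc p i k).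

Definition sinyukov_space : Prop := ~ constant_scal /\ sinyukov_equation.

End Classes.

(* Main.v *)
Require Import Defs.
From mathcomp Require Import all_boot all_order all_algebra.
From mathcomp Require Import all_classical all_reals all_analysis.
From mathcomp Require Import ring lra.

(* Omega_3 is the space of the tensors
     pure_trace t = t_i g_kj + t_j g_ik - 5 t_k g_ij :
   such a tensor pairs with w in Omega to -5 times the pairing of t with the
   trace g^ij w_kij, and this trace is zero on Omega_1 and Omega_2; conversely,
   Omega_1 + Omega_2 contains every trace-free element of Omega, and testing
   w in Omega_3 against these shows that w is determined by its trace.
   Since nabla g = 0, nabla T = nabla Ric - (1/2) ds g has trace -ds, so
   nabla T in Omega_3 amounts to nabla T = pure_trace (ds / 18), which is the
   Sinyukov equation. The divergence condition is part of this formula, so the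
   Bianchi identity plays no role. *)

Set Implicit Arguments.
Unset Strict Implicit.
Unset Printing Implicit Defensive.

Import Order.TTheory GRing.Theory Num.Theory.
Import numFieldNormedType.Exports.

Local Open Scope classical_set_scope.
Local Open Scope ring_scope.

(** * Smooth functions on an open set: closure properties and derivation rules *)

Section SmoothFunctions.
Variables (R : realType) (U : set 'rV[R]_4).
Hypothesis oU : open U.
Implicit Types (f h : 'rV[R]_4 -> R) (p : 'rV[R]_4) (k : nat) (i : 'I_4).

Lemma near_eq_on f h p : {in U, f =1 h} -> U p -> {near p, f =1 h}.
Proof.
move=> fh Up; have : \forall q \near p, U q by exact: open_nbhs_nbhs.
by apply: filterS => q Uq; apply: fh; rewrite inE.
Qed.

Lemma partial_eq_on f h i p : {in U, f =1 h} -> U p ->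
  partial i f p = partial i h p.
Proof. by move=> fh Up; apply: near_eq_derive; exact: near_eq_on. Qed.

Lemma continuous_on_ext f h p : {in U, f =1 h} -> U p ->
  {for p, continuous f} -> {for p, continuous h}.
Proof.
move=> fh Up; rewrite /prop_for /continuous_at fh ?inE//.
by apply: cvg_trans; exact: near_eq_cvg (near_eq_on fh Up).
Qed.

(** Functions equal on an open set agree near each of its points, hence so do their derivatives
    there. Formulas for derivatives hold on [U] only, and this lemma lets them stand in for the
    derivatives in the inductions below. *)
Lemma Ck_on_ext k f h : {in U, f =1 h} -> Ck_on k U f -> Ck_on k U h.
Proof.
elim: k f h => [|k IH] f h fh [cf df]; split=> //.
- by move=> p Up; exact: continuous_on_ext fh Up (cf p Up).
- by move=> p Up; exact: continuous_on_ext fh Up (cf p Up).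
move=> i; have [dfi Cfi] := df i; split=> [p Up|].
  exact: near_eq_derivable (near_eq_on fh Up) (dfi p Up).
by apply: IH Cfi => p; rewrite inE => Up; exact: partial_eq_on.
Qed.

Lemma Ck_onW k f : Ck_on k.+1 U f -> Ck_on k U f.
Proof.
elim: k f => [|k IH] f [cf df]; split=> // i.
by have [dfi /IH Cfi] := df i; split.
Qed.

Lemma Ck_on_cst k (a : R) : Ck_on k U (fun=> a).
Proof.
elim: k a => [|k IH] a; (split; first by move=> p _; exact: cst_continuous).
  by [].
move=> i.
split=> [p _|]; first exact: derivable_cst.
by apply: Ck_on_ext (IH 0) => p _; rewrite /partial derive_cst.
Qed.

Lemma Ck_onD k f h : Ck_on k U f -> Ck_on k U h ->
  Ck_on k U (fun p => f p + h p).
Proof.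
elim: k f h => [|k IH] f h [cf df] [ch dh].
  by split=> // p Up; exact: cvgD (cf p Up) (ch p Up).
split=> [p Up|i]; first by exact: cvgD (cf p Up) (ch p Up).
have [dfi Cfi] := df i; have [dhi Chi] := dh i; split=> [p Up|].
  by apply: derivableD; [exact: dfi|exact: dhi].
apply: Ck_on_ext (IH _ _ Cfi Chi) => p; rewrite inE => Up.
by rewrite /partial deriveD//; [exact: dfi|exact: dhi].
Qed.

Lemma Ck_onM k f h : Ck_on k U f -> Ck_on k U h ->
  Ck_on k U (fun p => f p * h p).
Proof.
elim: k f h => [|k IH] f h Cf Ch; have [cf df] := Cf; have [ch dh] := Ch.
  by split=> // p Up; exact: cvgM (cf p Up) (ch p Up).
split=> [p Up|i]; first by exact: cvgM (cf p Up) (ch p Up).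
have [dfi Cfi] := df i; have [dhi Chi] := dh i; split=> [p Up|].
  by apply: derivableM; [exact: dfi|exact: dhi].
(* In the product rule each factor multiplies a derivative of the other, which is of class [k] only;
   the factors are weakened to the same class. *)
apply: Ck_on_ext (Ck_onD (IH _ _ (Ck_onW Cf) Chi) (IH _ _ (Ck_onW Ch) Cfi)).
move=> p; rewrite inE => Up.
by rewrite /partial deriveM//; [exact: dfi|exact: dhi].
Qed.

Lemma Ck_onV k f : {in U, forall p, f p != 0} -> Ck_on k U f ->
  Ck_on k U (fun p => (f p)^-1).
Proof.
move=> f0; elim: k => [|k IH] Cf; have [cf df] := Cf.
  by split=> // p Up; apply: cvgV (cf p Up); apply: f0; rewrite inE.
split=> [p Up|i]; first by apply: cvgV (cf p Up); apply: f0; rewrite inE.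
have [dfi Cfi] := df i; split=> [p Up|].
  by apply: derivableV; [apply: f0; rewrite inE|exact: dfi].
have CV := IH (Ck_onW Cf).
(* The derivative of 1/f is - (1/f)^2 f', where 1/f is of class [k] by induction. *)
apply: Ck_on_ext (Ck_onM (Ck_on_cst k (-1)) (Ck_onM (Ck_onM CV CV) Cfi)).
move=> p; rewrite inE => Up; have fp0 : f p != 0 by apply: f0; rewrite inE.
rewrite /partial deriveV//; last exact: dfi.
by rewrite mulN1r -expr2 exprVn -mulNr.
Qed.

Lemma smooth_on_ext f h : {in U, f =1 h} -> smooth_on U f -> smooth_on U h.
Proof. by move=> fh Sf k; exact: Ck_on_ext (Sf k). Qed.

Lemma smooth_on_cst (a : R) : smooth_on U (fun=> a).
Proof. by move=> k; exact: Ck_on_cst. Qed.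

Lemma smooth_onD f h : smooth_on U f -> smooth_on U h ->
  smooth_on U (fun p => f p + h p).
Proof. by move=> Sf Sh k; exact: Ck_onD. Qed.

Lemma smooth_onM f h : smooth_on U f -> smooth_on U h ->
  smooth_on U (fun p => f p * h p).
Proof. by move=> Sf Sh k; exact: Ck_onM. Qed.

Lemma smooth_onN f : smooth_on U f -> smooth_on U (fun p => - f p).
Proof.
move=> Sf; apply: smooth_on_ext (smooth_onM (smooth_on_cst (-1)) Sf) => p _.
by rewrite mulN1r.
Qed.

Lemma smooth_onB f h : smooth_on U f -> smooth_on U h ->
  smooth_on U (fun p => f p - h p).
Proof. by move=> Sf /smooth_onN; exact: smooth_onD. Qed.

Lemma smooth_onV f : {in U, forall p, f p != 0} -> smooth_on U f ->
  smooth_on U (fun p => (f p)^-1).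
Proof. by move=> f0 Sf k; exact: Ck_onV. Qed.

Lemma smooth_on_sum (I : finType) (F : I -> 'rV[R]_4 -> R) :
  (forall a, smooth_on U (F a)) -> smooth_on U (fun p => \sum_a F a p).
Proof.
move=> SF; elim: (index_enum I) => [|a r IH].
  by apply: smooth_on_ext (smooth_on_cst 0) => p _; rewrite big_nil.
apply: smooth_on_ext (smooth_onD (SF a) IH) => p _; by rewrite big_cons.
Qed.

Lemma smooth_on_prod (I : finType) (F : I -> 'rV[R]_4 -> R) :
  (forall a, smooth_on U (F a)) -> smooth_on U (fun p => \prod_a F a p).
Proof.
move=> SF; elim: (index_enum I) => [|a r IH].
  by apply: smooth_on_ext (smooth_on_cst 1) => p _; rewrite big_nil.
apply: smooth_on_ext (smooth_onM (SF a) IH) => p _; by rewrite big_cons.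
Qed.

Lemma smooth_on_partial i f : smooth_on U f -> smooth_on U (partial i f).
Proof. by move=> Sf k; have [_ /(_ i)[]] := Sf k.+1. Qed.

Lemma smooth_on_derivable i f p : smooth_on U f -> U p ->
  derivable f p (delta_mx 0 i).
Proof. by move=> Sf Up; have [_ /(_ i)[+ _]] := Sf 1%N; exact. Qed.

(** By the Leibniz expansion, the determinant is a polynomial in the entries. *)
Lemma smooth_on_det n (A : 'rV[R]_4 -> 'M[R]_n) :
  (forall a b, smooth_on U (fun p => A p a b)) ->
  smooth_on U (fun p => \det (A p)).
Proof.
move=> SA; apply: smooth_on_sum => s; apply: smooth_onM.
  exact: smooth_on_cst.
by apply: smooth_on_prod => i; exact: SA.
Qed.

(** Cramer's formula: the entries of the inverse are cofactors divided by the determinant, which has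
    no zero on [U]. *)
Lemma smooth_on_invmx n (A : 'rV[R]_4 -> 'M[R]_n) :
  (forall a b, smooth_on U (fun p => A p a b)) ->
  {in U, forall p, A p \in unitmx} ->
  forall a b, smooth_on U (fun p => invmx (A p) a b).
Proof.
move=> SA uA a b.
have Sadj : smooth_on U (fun p => (\det (A p))^-1 * cofactor (A p) b a).
  apply: smooth_onM.
    apply: smooth_onV; last exact: smooth_on_det.
    by move=> p /uA; rewrite unitmxE unitfE.
  apply: smooth_onM; first exact: smooth_on_cst.
  apply: smooth_on_det => a' b'.
  apply: smooth_on_ext (SA (lift b a') (lift a b')).
  by move=> p _; rewrite !mxE.
by apply: smooth_on_ext Sadj => p /uA Ap; rewrite /invmx Ap !mxE.
Qed.

Section PartialRules.
Variables (f h : 'rV[R]_4 -> R) (p : 'rV[R]_4) (i : 'I_4).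
Hypotheses (Sf : smooth_on U f) (Sh : smooth_on U h) (Up : U p).

Lemma partialB :
  partial i (fun q => f q - h q) p = partial i f p - partial i h p.
Proof. by rewrite /partial deriveB//; exact: smooth_on_derivable. Qed.

Lemma partialM :
  partial i (fun q => f q * h q) p = f p * partial i h p + h p * partial i f p.
Proof. by rewrite /partial deriveM//; exact: smooth_on_derivable. Qed.

End PartialRules.

Lemma partial_sum (I : finType) (F : I -> 'rV[R]_4 -> R) p i :
  (forall a, smooth_on U (F a)) -> U p ->
  partial i (fun q => \sum_a F a q) p = \sum_a partial i (F a) p.
Proof.
move=> SF Up.
(* Smoothness of the partial sums is carried through the induction, since the rule for the
   derivative of a sum needs both summands derivable. *)
suff: smooth_on U (fun q => \sum_a F a q) /\
  partial i (fun q => \sum_a F a q) p = \sum_a partial i (F a) p by case.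
elim: (index_enum I) => [|a r [Sr IH]].
  have E : {in U, (fun=> 0) =1 (fun q => \sum_(b <- [::]) F b q)}.
    by move=> q _; rewrite big_nil.
  split; first exact: smooth_on_ext E (smooth_on_cst 0).
  by rewrite -(partial_eq_on _ E)// big_nil /partial derive_cst.
have E : {in U, (fun q => F a q + \sum_(b <- r) F b q) =1
    (fun q => \sum_(b <- a :: r) F b q)} by move=> q _; rewrite big_cons.
split; first exact: smooth_on_ext E (smooth_onD (SF a) Sr).
rewrite -(partial_eq_on _ E)// big_cons -IH /partial deriveD//.
  exact: smooth_on_derivable.
exact: smooth_on_derivable.
Qed.

End SmoothFunctions.

(** * Contractions and the inner product of tensors at a point *)

Section PointwiseAlgebra.
Variables (R : realType) (G : 'M[R]_4).
Hypotheses (Gsym : G^T = G) (Gunit : G \in unitmx).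
Local Notation H := (invmx G).
Implicit Types (w u v y : trilinear R) (t a b : 'I_4 -> R).

Lemma metricC i j : G i j = G j i.
Proof. by rewrite -{1}Gsym mxE. Qed.

Lemma invmetricC i j : H i j = H j i.
Proof. by rewrite -[in LHS]Gsym -trmx_inv mxE. Qed.

Lemma sum_delta (f : 'I_4 -> R) j : \sum_i (i == j)%:R * f i = f j.
Proof.
rewrite (bigD1 j)//= eqxx mul1r big1 ?addr0// => i /negPf ->.
by rewrite mul0r.
Qed.

Lemma invmetricK i j : \sum_k H i k * G k j = (i == j)%:R.
Proof. by have := mulVmx Gunit => /matrixP/(_ i j); rewrite !mxE. Qed.

Lemma raise_lower t j : \sum_i \sum_k H i k * t k * G i j = t j.
Proof.
rewrite exchange_big /= -[RHS]sum_delta; apply: eq_bigr => k _.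
rewrite -invmetricK mulr_suml; apply: eq_bigr => i _.
by rewrite (invmetricC k); ring.
Qed.

(** The contraction g^ij f_ij. Its argument is a function of two indices, so that any two slots of a
    trilinear form can be contracted. *)
Definition mtrace (f : 'I_4 -> 'I_4 -> R) : R := \sum_i \sum_j H i j * f i j.

Lemma eq_mtrace f f' : (forall i j, f i j = f' i j) ->
  mtrace f = mtrace f'.
Proof.
by move=> E; apply: eq_bigr => i _; apply: eq_bigr => j _; rewrite E.
Qed.

Lemma mtraceD f f' : mtrace (fun i j => f i j + f' i j) =
  mtrace f + mtrace f'.
Proof.
rewrite -big_split; apply: eq_bigr => i _; rewrite -big_split.
by apply: eq_bigr => j _; rewrite mulrDr.
Qed.

Lemma mtraceZ c f : mtrace (fun i j => c * f i j) = c * mtrace f.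
Proof.
rewrite /mtrace mulr_sumr; apply: eq_bigr => i _; rewrite mulr_sumr.
by apply: eq_bigr => j _; rewrite mulrCA.
Qed.

Lemma mtraceB f f' : mtrace (fun i j => f i j - f' i j) =
  mtrace f - mtrace f'.
Proof.
rewrite -[in RHS]mulN1r -mtraceZ -mtraceD.
by apply: eq_mtrace => i j; rewrite mulN1r.
Qed.

Lemma mtrace0 : mtrace (fun _ _ => 0) = 0.
Proof. by rewrite -[RHS](mul0r (mtrace (fun _ _ => 0))) -mtraceZ mul0r. Qed.

Lemma mtraceC f : mtrace (fun i j => f j i) = mtrace f.
Proof.
rewrite /mtrace exchange_big; apply: eq_bigr => i _; apply: eq_bigr => j _.
by rewrite invmetricC.
Qed.

Lemma mtrace_metric : mtrace G = 4.
Proof.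
transitivity (\sum_(i < 4) 1 : R); last by rewrite sumr_const card_ord.
apply: eq_bigr => i _; transitivity (\sum_j H i j * G j i).
  by apply: eq_bigr => j _; rewrite (metricC i j).
by rewrite invmetricK eqxx.
Qed.

(** An index is raised and lowered again; this removes a factor [G] under a contraction. *)
Lemma mtrace_lower t j : mtrace (fun i k => t k * G i j) = t j.
Proof.
rewrite -[RHS]raise_lower; apply: eq_bigr => i _; apply: eq_bigr => k _.
by rewrite mulrA.
Qed.

Lemma mtrace_lowerl t j : mtrace (fun i k => t i * G k j) = t j.
Proof. by rewrite -mtraceC mtrace_lower. Qed.

Lemma mtraceM f c : mtrace (fun i j => f i j * c) = mtrace f * c.
Proof.
rewrite mulrC -mtraceZ; apply: eq_mtrace => i j; exact: mulrC.
Qed.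

Lemma exchange_mtrace (f : 'I_4 -> 'I_4 -> 'I_4 -> 'I_4 -> R) :
  mtrace (fun i j => mtrace (f i j)) =
  mtrace (fun k l => mtrace (fun i j => f i j k l)).
Proof.
rewrite /mtrace.
under eq_bigr do under eq_bigr do rewrite mulr_sumr.
under eq_bigr do rewrite exchange_big.
rewrite exchange_big; apply: eq_bigr => k _ /=.
under eq_bigr do under eq_bigr do rewrite mulr_sumr.
under eq_bigr do rewrite exchange_big.
rewrite exchange_big; apply: eq_bigr => l _ /=.
rewrite mulr_sumr; apply: eq_bigr => i _; rewrite !mulr_sumr.
by apply: eq_bigr => j _; ring.
Qed.

(** Nesting one contraction per slot makes the rules for a single trace available in each slot
    separately. *)
Lemma innerE w u : inner G w u =
  mtrace (fun k k' => mtrace (fun i i' => mtrace (fun j j' =>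
    w k i j * u k' i' j'))).
Proof.
rewrite /inner /mtrace; apply: eq_bigr => k _.
under eq_bigr do rewrite exchange_big.
rewrite exchange_big; apply: eq_bigr => k' _ /=; rewrite mulr_sumr.
apply: eq_bigr => i _; rewrite exchange_big mulr_sumr.
apply: eq_bigr => i' _ /=; rewrite !mulr_sumr.
apply: eq_bigr => j _; rewrite !mulr_sumr.
by apply: eq_bigr => j' _; ring.
Qed.

Lemma eq_inner w u v : (forall k i j, u k i j = v k i j) ->
  inner G w u = inner G w v.
Proof.
move=> uv; rewrite !innerE; do 3!apply: eq_mtrace => ? ?.
by rewrite uv.
Qed.

Lemma innerDr w u v : inner G w (fun k i j => u k i j + v k i j) =
  inner G w u + inner G w v.
Proof.
rewrite !innerE -mtraceD; apply: eq_mtrace => k k'.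
rewrite -mtraceD; apply: eq_mtrace => i i'.
by rewrite -mtraceD; apply: eq_mtrace => j j'; rewrite mulrDr.
Qed.

Lemma innerZr w c u : inner G w (fun k i j => c * u k i j) = c * inner G w u.
Proof.
rewrite !innerE -mtraceZ; apply: eq_mtrace => k k'.
rewrite -mtraceZ; apply: eq_mtrace => i i'.
by rewrite -mtraceZ; apply: eq_mtrace => j j'; rewrite mulrCA.
Qed.

Lemma innerBr w u v : inner G w (fun k i j => u k i j - v k i j) =
  inner G w u - inner G w v.
Proof.
rewrite -[in RHS]mulN1r -innerZr -innerDr.
by apply: eq_inner => k i j; rewrite mulN1r.
Qed.

Lemma inner_sym w u : inner G w u = inner G u w.
Proof.
rewrite !innerE -mtraceC; apply: eq_mtrace => k k'.
rewrite -mtraceC; apply: eq_mtrace => i i'.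
by rewrite -mtraceC; apply: eq_mtrace => j j'; rewrite mulrC.
Qed.

Lemma inner_swap23 w u :
  inner G (fun k i j => w k j i) (fun k i j => u k j i) = inner G w u.
Proof.
by rewrite !innerE; apply: eq_mtrace => k k'; rewrite exchange_mtrace.
Qed.

(** The factor g_ij raises to a contraction of the last two slots of [w], leaving a pairing of
    covectors. *)
Lemma inner_metric23 w a : inner G w (fun k i j => a k * G i j) =
  mtrace (fun k k' => mtrace (w k) * a k').
Proof.
rewrite innerE; apply: eq_mtrace => k k'; rewrite -mtraceM.
apply: eq_mtrace => i i'; rewrite mulrC.
rewrite -[in RHS](mtrace_lowerl (w k i)) -mtraceZ.
by apply: eq_mtrace => j j'; rewrite (metricC i'); ring.
Qed.

Lemma inner_metric13 w a : inner G w (fun k i j => a i * G k j) =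
  mtrace (fun i i' => mtrace (fun k j => w k i j) * a i').
Proof.
rewrite innerE exchange_mtrace; apply: eq_mtrace => i i'.
rewrite -mtraceM; apply: eq_mtrace => k k'.
rewrite mulrC -[in RHS](mtrace_lowerl (w k i)) -mtraceZ.
by apply: eq_mtrace => j j'; rewrite (metricC k'); ring.
Qed.

(** The second argument is the metric dual of e_a (x) e_b (x) e_c, so pairing with it reads off one
    component of [w]. *)
Lemma inner_lowered w (a b c : 'I_4) :
  inner G w (fun k i j => G k a * (G i b * G j c)) = w a b c.
Proof.
rewrite innerE -[RHS](mtrace_lowerl (fun k => w k b c)).
apply: eq_mtrace => k k'.
rewrite -(mtrace_lowerl (fun i => w k i c) b) -mtraceM.
apply: eq_mtrace => i i'.
rewrite -(mtrace_lowerl (w k i) c) -!mtraceM.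
by apply: eq_mtrace => j j'; ring.
Qed.

(** * The pure-trace tensors and the identification of Omega_3 *)

Definition pure_trace t : trilinear R :=
  fun k i j => t i * G k j + t j * G i k - 5 * (t k * G i j).

(** The pairing contracts the first and third slots of [w]; by symmetry in the last two slots this
    is the divergence, which vanishes on Omega. *)
Lemma Omega_inner_metric13 w a : in_Omega G w ->
  inner G w (fun k i j => a i * G k j) = 0.
Proof.
move=> [wS wT]; rewrite inner_metric13 -mtrace0; apply: eq_mtrace => i i'.
rewrite -[RHS](mul0r (a i')); congr (_ * _); rewrite -[RHS](wT i).
by apply: eq_mtrace => k j; exact: wS.
Qed.

Lemma Omega_inner_metric12 w a : in_Omega G w ->
  inner G w (fun k i j => a j * G i k) = 0.
Proof.
move=> wO; rewrite -(Omega_inner_metric13 a wO) -inner_swap23.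
case: wO => wS _; rewrite inner_sym [RHS]inner_sym.
rewrite !innerE; do 3!apply: eq_mtrace => ? ?.
by rewrite wS (metricC _ _).
Qed.

Lemma inner_pure_trace w t : in_Omega G w ->
  inner G w (pure_trace t) = - 5 * mtrace (fun k k' => mtrace (w k) * t k').
Proof.
move=> wO; have E k i j : pure_trace t k i j =
    (t i * G k j + t j * G i k) + (- 5) * (t k * G i j).
  by rewrite /pure_trace; ring.
rewrite (eq_inner _ E) !innerDr innerZr inner_metric23.
by rewrite Omega_inner_metric13// Omega_inner_metric12// !add0r.
Qed.

(** In dimension 4 the three terms contribute t_j, 4 t_j and -5 t_j; this fixes the coefficient
    5. *)
Lemma pure_trace_div t j : mtrace (fun k i => pure_trace t k i j) = 0.
Proof.
have E k i : pure_trace t k i j =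
    t i * G j k + ((t j * G k i) + (- 5) * (t k * G i j)).
  by rewrite /pure_trace (metricC k j) (metricC i k); ring.
rewrite (eq_mtrace E) !mtraceD !mtraceZ mtrace_lowerl.
rewrite mtrace_metric.
have -> : mtrace (fun k i => t i * G j k) = t j.
  rewrite -[RHS]mtrace_lower; apply: eq_mtrace => k i.
  by rewrite (metricC j).
ring.
Qed.

Lemma pure_trace_in_Omega t : in_Omega G (pure_trace t).
Proof.
split=> [k i j|j]; last exact: pure_trace_div.
by rewrite /pure_trace (metricC i j) (metricC i k) (metricC j k); ring.
Qed.

(** Contract the cyclic identity over i and j: the second and third terms become divergences. *)
Lemma Omega1_trace u k : in_Omega1 G u -> mtrace (u k) = 0.
Proof.
move=> [[uS uT] uC].
have uT' : mtrace (fun i j => u i j k) = 0 by exact: uT.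
have : mtrace (fun i j => (u k i j + u i j k) + u j k i) = 0.
  by rewrite -mtrace0; apply: eq_mtrace => i j; exact: uC.
have uT'' : mtrace (fun i j => u j k i) = 0.
  by rewrite -mtraceC -uT'; apply: eq_mtrace => i j; exact: uS.
by rewrite !mtraceD uT' uT'' !addr0.
Qed.

(** Such a form is totally symmetric, so its trace equals its divergence. *)
Lemma Omega2_trace u k : in_Omega2 G u -> mtrace (u k) = 0.
Proof.
move=> [[uS uT] uC]; rewrite -[RHS](uT k); apply: eq_mtrace => i j.
by rewrite uC uS.
Qed.

Lemma pure_trace_in_Omega3 t : in_Omega3 G (pure_trace t).
Proof.
split=> [|u v u1 v2]; first exact: pure_trace_in_Omega.
have Z w : in_Omega G w -> (forall k, mtrace (w k) = 0) ->
    inner G (pure_trace t) w = 0.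
  move=> wO w0; rewrite inner_sym inner_pure_trace//.
  rewrite -(mulr0 (- 5)) -mtrace0; congr (_ * _).
  by apply: eq_mtrace => k k'; rewrite w0 mul0r.
rewrite innerDr !Z ?addr0//.
- by case: v2.
- by move=> k; exact: Omega2_trace.
- by case: u1.
- by move=> k; exact: Omega1_trace.
Qed.

(* The trace-free part of an element of Omega splits as its cyclic mean, in
   Omega2, plus the rest, in Omega1. *)
Lemma inner_Omega3_trace_free w x : in_Omega3 G w -> in_Omega G x ->
  (forall k, mtrace (x k) = 0) -> inner G w x = 0.
Proof.
move=> [_ wO] [xS xT] x0.
pose v : trilinear R := fun k i j => 3^-1 * (x k i j + x i j k + x j k i).
pose u : trilinear R := fun k i j => x k i j - v k i j.
have {}xT j : mtrace (fun k i => x k i j) = 0 := xT j.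
have xT' j : mtrace (fun k i => x i j k) = 0.
  by rewrite -(xT j) -mtraceC; apply: eq_mtrace => k i; exact: xS.
(* Contracting the cyclic mean gives two divergences of [x] and the trace of [x], which is zero by
   [x0]. *)
have vT j : mtrace (fun k i => v k i j) = 0.
  by rewrite /v mtraceZ !mtraceD xT xT' x0 !addr0 mulr0.
have vO : in_Omega G v.
  by split=> [k i j|//]; rewrite /v (xS k j) (xS j i) (xS i k); ring.
have uO : in_Omega G u.
  split=> [k i j|j]; first by rewrite /u (xS k j) vO.1.
  by rewrite -[LHS]/(mtrace _) mtraceB vT xT subrr.
have v2 : in_Omega2 G v.
  by split=> // k i j; rewrite /v (xS i k) (xS k j) (xS j i); ring.
(* The cyclic mean [v] has the same cyclic sum as [x], so that of [u] vanishes. *)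
have u1 : in_Omega1 G u by split=> // k i j; rewrite /u /v; field.
rewrite -[RHS](wO _ _ u1 v2); apply: eq_inner => k i j.
by rewrite /u subrK.
Qed.

(* [w] is tested against the trace-free part of the ij-symmetrization of
   [G k a * G i b * G j c], whose pairing with [w] lowers the indices; [al] and
   [be] solve [4 al + 2 be = A], [al + 5 be = B], where [A] and [B] are the two
   traces of the symmetrization. *)
Lemma Omega3_pure_trace w t : in_Omega3 G w ->
  (forall k, mtrace (w k) = - t k) ->
  forall a b c : 'I_4, w a b c = pure_trace (fun k => 18^-1 * t k) a b c.
Proof.
move=> wO3 wt a b c; have wO := wO3.1.
pose A k := G k a * G b c; pose B j := 2^-1 * (G a b * G j c + G a c * G j b).
pose al k := 18^-1 * (5 * A k - 2 * B k); pose be k := 18^-1 * (4 * B k - A k).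
pose y : trilinear R := fun k i j => 2^-1 *
  (G k a * (G i b * G j c) + G k a * (G i c * G j b)).
(* [z] is assembled from the metric so as to have the same trace and the same divergence as [y]. *)
pose z : trilinear R := fun k i j =>
  al k * G i j + (be i * G k j + be j * G i k).
pose x : trilinear R := fun k i j => y k i j - z k i j.
have yS k i j : y k i j = y k j i by rewrite /y; ring.
have zS k i j : z k i j = z k j i.
  by rewrite /z (metricC i j) (metricC i k) (metricC j k); ring.
have yT k : mtrace (y k) = A k.
  rewrite /y mtraceZ mtraceD !mtraceZ !mtrace_lowerl /A.
  by rewrite (metricC c b); field.
have yD j : mtrace (fun k i => y k i j) = B j.
  have E k i : y k i j =
      2^-1 * (G j c * (G k a * G i b) + G j b * (G k a * G i c)).
    by rewrite /y; ring.
  rewrite (eq_mtrace E) mtraceZ mtraceD !mtraceZ !mtrace_lowerl /B.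
  by rewrite (metricC a b) (metricC a c); ring.
have zT k : mtrace (z k) = 4 * al k + 2 * be k.
  rewrite /z !mtraceD mtraceZ mtrace_metric.
  have -> : mtrace (fun i j => be i * G k j) = be k.
    rewrite -[RHS]mtrace_lowerl; apply: eq_mtrace => i j.
    by rewrite (metricC k).
  by rewrite mtrace_lower; ring.
have zD j : mtrace (fun k i => z k i j) = al j + 5 * be j.
  have E k i : z k i j = al k * G i j + (be i * G j k + be j * G k i).
    by rewrite /z (metricC j) (metricC k i).
  rewrite (eq_mtrace E) !mtraceD mtraceZ mtrace_metric mtrace_lowerl.
  have -> : mtrace (fun k i => be i * G j k) = be j.
    rewrite -[RHS]mtrace_lower; apply: eq_mtrace => i k.
    by rewrite (metricC j).
  by ring.
have xO : in_Omega G x.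
  split=> [k i j|j]; first by rewrite /x yS zS.
  by rewrite -[LHS]/(mtrace _) mtraceB yD zD /al /be; field.
have xT k : mtrace (x k) = 0.
  by rewrite mtraceB yT zT /al /be; field.
have := inner_Omega3_trace_free wO3 xO xT.
(* The pairing of [w] with [y] is w_abc. In the pairing with [z] the two [be] terms vanish because
   [w] is divergence-free, and the [al] term involves only the trace of [w]. *)
rewrite innerBr innerZr innerDr !inner_lowered !innerDr inner_metric23.
rewrite Omega_inner_metric13// Omega_inner_metric12//.
rewrite (wO.1 a c b).
have E k k' : mtrace (w k) * al k' = - (18^-1 * (5 * G b c)) * (t k * G k' a)
    + (18^-1 * G a b * (t k * G k' c) + 18^-1 * G a c * (t k * G k' b)).
  by rewrite wt /al /A /B; field.
rewrite (eq_mtrace E) !mtraceD !mtraceZ !mtrace_lowerl.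
by rewrite /pure_trace (metricC b a) => W; lra.
Qed.

(** With r = nabla_k R_ij and t = ds, the left side of the second equation is nabla_k T_ij; the
    coefficients match since 4/18 - 1/2 = -5/18. *)
Lemma sinyukov_pure_trace t r k i j :
  r = 18^-1 * (4 * t k * G i j + t i * G k j + t j * G i k) <->
  r - 2^-1 * t k * G i j = pure_trace (fun l => 18^-1 * t l) k i j.
Proof. by rewrite /pure_trace; split=> [->|E]; [field|lra]. Qed.

End PointwiseAlgebra.

(** * The Levi-Civita connection in one chart: smoothness of the curvature *)

Section LeviCivita.
Variables (R : realType) (U : set 'rV[R]_4) (g : 'rV[R]_4 -> 'M[R]_4).
Hypotheses (oU : open U) (Sg : forall i j, smooth_on U (fun p => g p i j)).
Hypotheses (gsym : forall p, U p -> (g p)^T = g p).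
Hypotheses (gunit : forall p, U p -> g p \in unitmx).
Implicit Types (p : 'rV[R]_4) (A B T : 'rV[R]_4 -> 'M[R]_4) (k : 'I_4).

Lemma smooth_metric_inv i j : smooth_on U (fun p => metric_inv g p i j).
Proof.
by apply: smooth_on_invmx => // p; rewrite inE; exact: gunit.
Qed.

Lemma smooth_christoffel k i j : smooth_on U (christoffel g k i j).
Proof.
apply: smooth_onM => //; first exact: smooth_on_cst.
apply: smooth_on_sum => // l; apply: smooth_onM => //.
  exact: smooth_metric_inv.
apply: smooth_onB => //; last exact: smooth_on_partial.
by apply: smooth_onD => //; exact: smooth_on_partial.
Qed.

Lemma smooth_nabla_vector (X : 'I_4 -> 'rV[R]_4 -> R) j k :
  (forall a, smooth_on U (X a)) -> smooth_on U (nabla_vector g X j k).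
Proof.
move=> SX; apply: smooth_onD => //; first exact: smooth_on_partial.
apply: smooth_on_sum => // m; apply: smooth_onM => //.
exact: smooth_christoffel.
Qed.

Lemma smooth_nabla_mixed (Y : 'I_4 -> 'I_4 -> 'rV[R]_4 -> R) i j k :
  (forall a b, smooth_on U (Y a b)) -> smooth_on U (nabla_mixed g Y i j k).
Proof.
move=> SY; apply: smooth_onB => //; first apply: smooth_onD => //.
- exact: smooth_on_partial.
- apply: smooth_on_sum => // m; apply: smooth_onM => //.
  exact: smooth_christoffel.
- apply: smooth_on_sum => // m; apply: smooth_onM => //.
  exact: smooth_christoffel.
Qed.

Lemma smooth_riemann k l i j : smooth_on U (riemann g k l i j).
Proof.
have SY a b : smooth_on U (nabla_vector g (@coord_field R l) a b).
  by apply: smooth_nabla_vector => c; exact: smooth_on_cst.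
by apply: smooth_onB => //; exact: smooth_nabla_mixed.
Qed.

Lemma smooth_ricci i j : smooth_on U (fun p => ricci g p i j).
Proof.
apply: (smooth_on_ext oU (f := fun p => \sum_k riemann g k i k j p)).
  by move=> p _; rewrite mxE.
by apply: smooth_on_sum => // k; exact: smooth_riemann.
Qed.

Lemma smooth_scal : smooth_on U (scal g).
Proof.
apply: smooth_on_sum => // i; apply: smooth_on_sum => // j.
by apply: smooth_onM => //; [exact: smooth_metric_inv|exact: smooth_ricci].
Qed.

(** * Matrix form of the covariant derivative, metric compatibility, and nabla T *)

Definition partial_mx k T p : 'M[R]_4 :=
  \matrix_(i, j) partial k (fun q => T q i j) p.

Definition christoffel_mx k p : 'M[R]_4 :=
  \matrix_(m, i) christoffel g m k i p.

(** For a fixed direction k, nabla_k T = d_k T - C^T T - T C with C the connection matrix, its upper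
    index numbering the rows. Sums over indices thus become matrix products. *)
Lemma nabla_covariantE T p k i j : nabla_covariant g T p k i j =
  (partial_mx k T p - (christoffel_mx k p)^T *m T p
   - T p *m christoffel_mx k p) i j.
Proof.
rewrite !mxE; congr (_ - _ - _); apply: eq_bigr => m _; rewrite !mxE//.
exact: mulrC.
Qed.

Lemma partial_mxM k A B p : U p ->
  (forall i j, smooth_on U (fun q => A q i j)) ->
  (forall i j, smooth_on U (fun q => B q i j)) ->
  partial_mx k (fun q => A q *m B q) p =
  partial_mx k A p *m B p + A p *m partial_mx k B p.
Proof.
move=> Up SA SB; apply/matrixP => i j; rewrite !mxE.
rewrite (partial_eq_on oU (h := fun q => \sum_m A q i m * B q m j))//;
  last first.
  by move=> q _; rewrite mxE.
rewrite (partial_sum oU)//; last by move=> m; apply: smooth_onM.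
rewrite -big_split; apply: eq_bigr => m _.
rewrite (partialM _ (SA i m) (SB m j))//.
by rewrite !mxE addrC; congr (_ + _); exact: mulrC.
Qed.

(** This is nabla g = 0. The matrix g C is half of [S] below, and in [S] + [S]^T everything but 2
    d_k g cancels. *)
Lemma christoffel_metric k p : U p ->
  (christoffel_mx k p)^T *m g p + g p *m christoffel_mx k p =
  partial_mx k g p.
Proof.
move=> Up.
(* Twice the Christoffel symbols of the first kind, in direction k. *)
pose S : 'M[R]_4 := \matrix_(l, j) (partial k (fun q => g q j l) p
  + partial j (fun q => g q k l) p - partial l (fun q => g q k j) p).
have -> : christoffel_mx k p = 2^-1 *: (invmx (g p) *m S).
  apply/matrixP => i j; rewrite !mxE; congr (_ * _).
  by apply: eq_bigr => l _; rewrite !mxE.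
have symP i j l :
    partial l (fun q => g q i j) p = partial l (fun q => g q j i) p.
  apply: (partial_eq_on oU) => // q; rewrite inE => Uq.
  by rewrite -[in LHS](gsym Uq) mxE.
have -> : (2^-1 *: (invmx (g p) *m S))^T *m g p = 2^-1 *: S^T.
  rewrite -[X in _ *m X](gsym Up) -trmx_mul -scalemxAr mulmxA.
  by rewrite mulmxV ?gunit// mul1mx linearZ.
rewrite -scalemxAr mulmxA mulmxV ?gunit// mul1mx.
apply/matrixP => i j; rewrite !mxE.
by rewrite (symP j i k) (symP k j i) (symP k i j); field.
Qed.

(** This is nabla g^-1 = 0, obtained by differentiating g^-1 g = 1 and substituting nabla g = 0. *)
Lemma partial_metric_inv k p : U p ->
  partial_mx k (metric_inv g) p =
  - (metric_inv g p *m (christoffel_mx k p)^T +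
     christoffel_mx k p *m metric_inv g p).
Proof.
move=> Up; have gU := gunit Up.
have : partial_mx k (fun q => metric_inv g q *m g q) p = 0.
  apply/matrixP => i j; rewrite !mxE.
  rewrite (partial_eq_on oU (h := fun=> (i == j)%:R))//.
    by rewrite /partial derive_cst.
  by move=> q; rewrite inE => Uq; rewrite mulVmx ?gunit// mxE.
rewrite partial_mxM//; last exact: smooth_metric_inv.
move/(congr1 (fun M => M *m invmx (g p))).
rewrite mul0mx mulmxDl mulmxK// => /eqP; rewrite addr_eq0 => /eqP ->.
rewrite -christoffel_metric// /metric_inv mulmxDr mulmxDl.
by rewrite !mulmxA mulmxK// mulVmx// mul1mx.
Qed.

Lemma sum_mxtrace (A B : 'M[R]_4) :
  \sum_i \sum_j A i j * B i j = \tr (A^T *m B).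
Proof.
rewrite /mxtrace exchange_big; apply: eq_bigr => j _; rewrite mxE.
by apply: eq_bigr => i _; rewrite mxE.
Qed.

(** Contraction commutes with the covariant derivative because the inverse metric is parallel. *)
Lemma partial_trace T p k : U p ->
  (forall i j, smooth_on U (fun q => T q i j)) ->
  partial k (fun q => \sum_i \sum_j metric_inv g q i j * T q i j) p =
  mtrace (g p) (nabla_covariant g T p k).
Proof.
move=> Up ST; have Sh := smooth_metric_inv.
have ShT i j : smooth_on U (fun q => metric_inv g q i j * T q i j).
  by apply: smooth_onM.
rewrite (partial_sum oU)//; last by move=> i; apply: smooth_on_sum.
transitivity (\sum_i \sum_j metric_inv g p i j * partial_mx k T p i j
  + \sum_i \sum_j partial_mx k (metric_inv g) p i j * T p i j).
  rewrite -big_split; apply: eq_bigr => i _.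
  rewrite (partial_sum oU)// -big_split; apply: eq_bigr => j _.
  by rewrite (partialM _ (Sh i j) (ST i j))// !mxE [X in _ + X]mulrC.
rewrite !sum_mxtrace partial_metric_inv//.
rewrite (eq_mtrace (g p) (fun i j => nabla_covariantE T p k i j)).
rewrite /mtrace sum_mxtrace.
have hT : (metric_inv g p)^T = metric_inv g p.
  by rewrite /metric_inv trmx_inv gsym.
rewrite linearN /= linearD /= !trmx_mul trmxK hT.
rewrite !mulmxBr !raddfB /= mulNmx mulmxDl.
rewrite raddfN raddfD /= mulmxA (mulmxA _ (T p)).
(* Cyclicity of the trace identifies tr(g^-1 T C) with tr(C g^-1 T), which comes from the derivative
   of g^-1. *)
rewrite [X in _ = _ - X]mxtrace_mulC mulmxA; ring.
Qed.

Lemma nabla_energy_momentumE p k i j : U p ->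
  nabla_covariant g (energy_momentum g) p k i j =
  nabla_covariant g (ricci g) p k i j - 2^-1 * partial k (scal g) p * g p i j.
Proof.
move=> Up; rewrite !nabla_covariantE.
have Sc : smooth_on U (fun q => 2^-1 * scal g q).
  by apply: smooth_onM => //; [exact: smooth_on_cst|exact: smooth_scal].
have -> : partial_mx k (energy_momentum g) p = partial_mx k (ricci g) p
   - ((2^-1 * partial k (scal g) p) *: g p +
      (2^-1 * scal g p) *: partial_mx k g p).
  apply/matrixP => a b; rewrite !mxE.
  rewrite (partial_eq_on oU (h := fun q => ricci g q a b -
      2^-1 * scal g q * g q a b))//; last by move=> q _; rewrite !mxE.
  have SM : smooth_on U (fun q => 2^-1 * scal g q * g q a b).
    by apply: smooth_onM.
  rewrite (partialB _ (smooth_ricci a b) SM)//; congr (_ - _).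
  rewrite (partialM _ Sc (Sg a b))//.
  rewrite (partialM _ (smooth_on_cst oU 2^-1) smooth_scal)//.
  by rewrite /partial derive_cst -!/(partial _ _ _); ring.
(* Writing d_k g through the connection matrix cancels the connection terms of s g, so that only the
   derivative of s remains. *)
rewrite /energy_momentum -christoffel_metric// mulmxBr mulmxBl.
rewrite -scalemxAr -scalemxAl.
rewrite !mxE; ring.
Qed.

(** The trace of nabla_k Ric is d_k s, and that of (1/2) d_k s g is 2 d_k s. *)
Lemma trace_nabla_energy_momentum p k : U p ->
  mtrace (g p) (nabla_covariant g (energy_momentum g) p k) =
  - partial k (scal g) p.
Proof.
move=> Up.
rewrite (eq_mtrace (g p) (fun i j => nabla_energy_momentumE k i j Up)).
under eq_mtrace do rewrite -mulNr.
rewrite mtraceD mtraceZ -partial_trace//; last exact: smooth_ricci.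
rewrite mtrace_metric ?gsym ?gunit// -[X in partial k X]/(scal g).
by field.
Qed.

End LeviCivita.

(* The zero section lies in Omega_3, and nabla T = 0 holds for instance on
   Minkowski space, whose scalar curvature is constant; the implication from
   left to right therefore excludes nabla T = 0 everywhere. *)
Theorem theorem4 (R : realType) (M : manifold4 R) (g : pseudo_metric M)
    (hg : lorentzian g) :
  (einstein_class_Omega3 g -> ~ parallel_energy_momentum g ->
     sinyukov_space g) /\
  (sinyukov_space g -> einstein_class_Omega3 g).
Proof.
have oU c : open (chart_img (c : chart R M)) by exact: chart_img_open.
have nablaE c p k i j : atlas c -> chart_img c p ->
    nabla_energy_momentum g c p k i j =
    nabla_covariant (metric_comp g c) (ricci (metric_comp g c)) p k i j
    - 2^-1 * partial k (scal (metric_comp g c)) p * metric_comp g c p i j.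
  move=> cA; apply: nabla_energy_momentumE => //.
  - exact: metric_smooth.
  - by move=> q; exact: Defs.metric_sym.
  - by move=> q; exact: metric_nondeg.
have trE c p k : atlas c -> chart_img c p ->
    mtrace (metric_comp g c p) (nabla_energy_momentum g c p k) =
    - partial k (scal (metric_comp g c)) p.
  move=> cA; apply: trace_nabla_energy_momentum => //.
  - exact: metric_smooth.
  - by move=> q; exact: Defs.metric_sym.
  - by move=> q; exact: metric_nondeg.
(* The trace of [pure_trace] t over its last two slots is -18 t, whereas nabla T has trace -ds;
   hence t = ds / 18. *)
have pureE c p : atlas c -> chart_img c p ->
    in_Omega3 (metric_comp g c p) (nabla_energy_momentum g c p) ->
    forall k i j, nabla_energy_momentum g c p k i j =
      pure_trace (metric_comp g c p)
        (fun l => 18^-1 * partial l (scal (metric_comp g c)) p) k i j.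
  move=> cA cp w3; apply: Omega3_pure_trace w3 _ => [||k].
  - exact: Defs.metric_sym.
  - exact: metric_nondeg.
  - exact: trE.
split.
  move=> O3 npar; split.
    (* If s were constant, ds would vanish in every chart, and with it nabla T, being the pure-trace
       tensor of ds / 18. *)
    move=> [a sa]; apply: npar => c p cA cp k i j.
    have ds l : partial l (scal (metric_comp g c)) p = 0.
      rewrite (partial_eq_on (oU c) (h := fun=> a))//.
        by rewrite /partial derive_cst.
      by move=> q; rewrite inE; exact: sa.
    rewrite pureE//; last exact: O3.
    by rewrite /pure_trace !ds !(mulr0, mul0r) addr0 subr0.
  move=> c p cA cp k i j /=.
  apply/(sinyukov_pure_trace _ (fun l => partial l (scal (metric_comp g c)) p)).
  by rewrite -nablaE// pureE//; exact: O3.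
move=> [_ SE] c p cA cp.
(* The Sinyukov equation is read backwards: it makes nabla T a pure-trace tensor, hence an element
   of Omega_3. *)
have -> : nabla_energy_momentum g c p = pure_trace (metric_comp g c p)
    (fun l => 18^-1 * partial l (scal (metric_comp g c)) p).
  apply/funext => k; apply/funext => i; apply/funext => j.
  rewrite nablaE//.
  apply/(sinyukov_pure_trace _ (fun l => partial l (scal (metric_comp g c)) p)).
  exact: SE.
by apply: pure_trace_in_Omega3; [exact: Defs.metric_sym|exact: metric_nondeg].
Qed.
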